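(* Let $\phi$ be a (topological) pseudo-Anosov flow on a compact $3$-manifold $M$. If the union of the periodic orbits of $\phi$ is dense in $M$, then $\phi$ is transitive, i.e. has a dense orbit.
   Context: Manifolds are connected and without boundary. A topological pseudo-Anosov flow on a compact $3$-manifold $M$ is a continuous flow $\phi$ without fixed points for which there are two $\phi$-invariant, transverse, two-dimensional (possibly singular) foliations $\mathcal F^s,\mathcal F^u$ such that: (i) the foliations are regular away from a finite (possibly empty) collection of periodic orbits, near which both are of $p$-prong type with $p\ge 3$ (locally modeled on the suspension of the stable/unstable foliations at a $p$-prong fixed point of a pseudo-Anosov homeomorphism), and leaves of $\mathcal F^s$ and $\mathcal F^u$ intersect along orbits; (ii) if $x,y$ lie in the same leaf of $\mathcal F^s$ there is an increasing homeomorphism $h:\mathbb R\to\mathbb R$ with $d(\phi^t(x),\phi^{h(t)}(y))\to 0$ as $t\to+\infty$, and similarly for $\mathcal F^u$ as $t\to-\infty$; (iii) there is $\varepsilon>0$ such that if $x,y$ lie in the same local leaf of $\mathcal F^s$ but not on the same local orbit then for every increasing homeomorphism $h$ of $\mathbb R$ with $h(0)=0$ there is $t\le 0$ with $d(\phi^t(x),\phi^{h(t)}(y))>\varepsilon$, and similarly for $\mathcal F^u$ with $t\ge 0$. (The notion is regarded in the paper as equivalent to that of an expansive flow on a compact $3$-manifold.) No smoothness is assumed. *)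

(* Defs.v *)
From HB Require Import structures.
From mathcomp Require Import all_boot all_order all_algebra.
From mathcomp Require Import all_classical all_reals all_analysis.
From mathcomp Require Import complex.

Set Implicit Arguments.
Unset Strict Implicit.
Unset Printing Implicit Defensive.
Import Order.TTheory GRing.Theory Num.Theory.
Import numFieldNormedType.Exports.
Local Open Scope classical_set_scope.
Local Open Scope ring_scope.

Definition homeo_between {X Y : topologicalType} (A : set X) (B : set Y)
    (f : X -> Y) : Prop :=
  exists g : Y -> X,
    [/\ {within A, continuous f}, {within B, continuous g},
        (forall x, A x -> B (f x) /\ g (f x) = x) &
        (forall y, B y -> A (g y) /\ f (g y) = y)].

Definition increasing_homeo {R : realType} (h : R -> R) : Prop :=
  homeo_between setT setT h /\ {homo h : s t / s < t}.

Definition path_component {R : realType} {X : topologicalType} (A : set X)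
    (x : X) : set X :=
  [set y | exists c : R -> X,
     [/\ {within `[0, 1], continuous c}, c 0 = x, c 1 = y &
         forall t : R, 0 <= t <= 1 -> A (c t)]].

Definition locally_euclidean (R : realType) (n : nat) (X : topologicalType) :
    Prop :=
  forall x : X, exists (U : set X) (V : set 'rV[R]_n) (f : X -> 'rV[R]_n),
    [/\ open U, U x, open V & homeo_between U V f].

(* [mdist] is an arbitrary metric compatible with the topology of [M];
   Hausdorffness and second countability follow from it. *)
Definition compact_connected_manifold (R : realType) (n : nat)
    (M : metricType R) : Prop :=
  [/\ [set: M] !=set0, compact [set: M], connected [set: M] &
      locally_euclidean R n M].

Record continuous_flow {R : realType} {M : topologicalType}
    (phi : R -> M -> M) : Prop := ContinuousFlow {
  flow_continuous : continuous (fun tx : R * M => phi tx.1 tx.2) ;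
  flow0 : forall x, phi 0 x = x ;
  flowD : forall s t x, phi (s + t) x = phi s (phi t x) }.

Definition flow_orbit {R : realType} {M : Type} (phi : R -> M -> M) (x : M) :
    set M := range (fun t => phi t x).

Definition fixed_point {R : realType} {M : Type} (phi : R -> M -> M) (x : M) :
    Prop := forall t, phi t x = x.

Definition periodic_point {R : realType} {M : Type} (phi : R -> M -> M)
    (x : M) : Prop := ~ fixed_point phi x /\ exists2 T : R, 0 < T & phi T x = x.

Definition transitive_flow {R : realType} {M : topologicalType}
    (phi : R -> M -> M) : Prop := exists x, dense (flow_orbit phi x).

Section ProngModel.
Context {R : realType}.
Implicit Types (p : nat) (z : R * R).

Definition re_pow p z : R := complex.Re (Complex z.1 z.2 ^+ p).

Definition modulus z : R := Num.sqrt (z.1 ^+ 2 + z.2 ^+ 2).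

(* In the (multivalued) coordinate w = z^(p/2) on the plane R * R = C, the two
   p-prong foliations are Im w = const (stable) and Re w = const (unstable).
   As w^2 = z^p, one has [prong_s p z] = 2 (Im w)^2 and
   [prong_u p z] = 2 (Re w)^2, so the leaves are exactly the connected
   components of the level sets of these two functions.  For p = 2 they are the
   horizontal and the vertical lines. *)
Definition prong_s p z : R := modulus z ^+ p - re_pow p z.
Definition prong_u p z : R := modulus z ^+ p + re_pow p z.

(* |Im w| and |Re w| bounded: a curvilinear 2p-gon around 0. *)
Definition prong_box p : set (R * R) :=
  [set z | prong_s p z < 1 /\ prong_u p z < 1].

(* A pseudo-Anosov homeomorphism near a p-prong fixed point: it preserves both
   foliations and multiplies their transverse measures |d Im w| and |d Re w| by
   lambda and lambda^-1.  It may permute the prongs. *)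
Definition pA_prong_map p (f : R * R -> R * R) : Prop :=
  homeo_between setT setT f /\
  exists2 lambda : R, 1 < lambda & forall z,
    prong_s p (f z) = lambda ^+ 2 * prong_s p z /\
    prong_u p (f z) = lambda ^- 2 * prong_u p z.

End ProngModel.

Section Foliations.
Context {R : realType} {M : metricType R}.
Implicit Types (phi : R -> M -> M) (F Fs Fu : M -> set M).

(* A (singular) foliation is given by the map sending a point to its leaf. *)
Record leaf_partition F : Prop := LeafPartition {
  leaf_refl : forall x, F x x ;
  leaf_eq : forall x y, F x y -> F x = F y ;
  leaf_path_connected : forall x, path_component (R := R) (F x) x = F x }.

Definition invariant_foliation phi F : Prop :=
  forall x t, F x (phi t x).

(* The component through [x] of the trace on [U] of a leaf or of an orbit. *)
Definition local_part (U : set M) (L : M -> set M) (x : M) : set M :=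
  connected_component (L x `&` U) x.

Definition model_domain (p : nat) (a b : R) : set (R * R * R) :=
  prong_box p `*` [set` `]a, b[].

Definition model_plaque (p : nat) (a b : R) (q : R * R -> R) (v : R * R * R) :
    set (R * R * R) :=
  connected_component (model_domain p a b `&` [set w | q w.1 = q v.1]) v.

(* [H] is the inverse of a chart, on the open set [U], in which [Fs] and [Fu]
   become the product of the two p-prong foliations with an interval.  For
   p = 2 this is the standard model of two transverse regular foliations. *)
Definition bifoliated_chart Fs Fu (p : nat) (a b : R) (H : R * R * R -> M)
    (U : set M) : Prop :=
  [/\ open U, homeo_between (model_domain p a b) U H &
      forall v, model_domain p a b v ->
        local_part U Fs (H v) = H @` model_plaque p a b (prong_s p) v /\
        local_part U Fu (H v) = H @` model_plaque p a b (prong_u p) v].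

Definition regular_at Fs Fu (x : M) : Prop :=
  exists (H : R * R * R -> M) (U : set M),
    bifoliated_chart Fs Fu 2 (-1) 1 H U /\ H (0, 0, 0) = x.

(* Near the orbit of [x] the foliations are the suspension of the p-prong
   foliations under [f], i.e. the quotient of the product foliations by
   (z, t) ~ (f z, t - 1), the orbit being the core z = 0.  Since [f] does not
   preserve the box, [H] is only the restriction of the quotient map to
   [prong_box p `*` `]-1, 1[]; it is a chart on each open interval of length 1.
   The size of the box is immaterial, by homogeneity of the model. *)
Definition prong_type_along_orbit phi Fs Fu (p : nat) (x : M) : Prop :=
  exists (f : R * R -> R * R) (H : R * R * R -> M),
    [/\ pA_prong_map p f,
        (forall a : R, -1 <= a <= 0 -> exists U : set M,
           bifoliated_chart Fs Fu p a (a + 1) H U),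
        (forall z t, prong_box p z -> prong_box p (f z) -> 0 < t < 1 ->
           H (z, t) = H (f z, t - 1)) &
        [set H (0, 0, t) | t in [set` `]-1, 1[]] = flow_orbit phi x].

(* Transversality of the foliations is part of [bifoliated_chart]. *)
Record pA_foliations phi Fs Fu : Prop := PAFoliations {
  singular_orbits : exists S : set M,
    [/\ finite_set S, S `<=` periodic_point phi,
        (forall x, S x -> exists2 p : nat, (3 <= p)%N &
           prong_type_along_orbit phi Fs Fu p x) &
        (forall y, ~ (\bigcup_(x in S) flow_orbit phi x) y -> regular_at Fs Fu y)] ;
  leaves_meet_along_orbits : forall x,
    path_component (R := R) (Fs x `&` Fu x) x = flow_orbit phi x }.

Definition foliated_box Fs Fu (U : set M) : Prop :=
  exists (p : nat) (a b : R) (H : R * R * R -> M),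
    [/\ (2 <= p)%N, a < b & bifoliated_chart Fs Fu p a b H U].

Definition asymptotic_along phi F (T : set_system R) : Prop :=
  forall x y, F x y -> exists2 h : R -> R, increasing_homeo h &
    (fun t => mdist (phi t x) (phi (h t) y)) @ T --> (0 : R).

(* Local leaves and local orbits are taken in some foliated box around each
   point, with a single [eps] for all of them. *)
Definition separating_along phi Fs Fu F (T : set R) : Prop :=
  exists2 eps : R, 0 < eps & forall x0 : M, exists U : set M,
    [/\ foliated_box Fs Fu U, U x0 &
      forall x y, U x -> local_part U F x y ->
        ~ local_part U (flow_orbit phi) x y ->
        forall h : R -> R, increasing_homeo h -> h 0 = 0 ->
          exists2 t, T t & eps < mdist (phi t x) (phi (h t) y)].

Record topological_pseudo_Anosov phi : Prop := TopologicalPseudoAnosov {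
  pA_flow : continuous_flow phi ;
  pA_no_fixed_point : forall x, ~ fixed_point phi x ;
  pA_exists_foliations : exists Fs Fu : M -> set M,
    [/\ leaf_partition Fs /\ leaf_partition Fu,
        invariant_foliation phi Fs /\ invariant_foliation phi Fu,
        pA_foliations phi Fs Fu,
        asymptotic_along phi Fs +oo /\ asymptotic_along phi Fu -oo &
        separating_along phi Fs Fu Fs [set t | t <= 0] /\
        separating_along phi Fs Fu Fu [set t | 0 <= t]] }.

End Foliations.

(* Main.v *)
Require Import Defs.
From HB Require Import structures.
From mathcomp Require Import all_boot all_order all_algebra.
From mathcomp Require Import all_classical all_reals all_analysis.
From mathcomp Require Import complex ring lra.
Import Order.TTheory GRing.Theory Num.Theory.
Import numFieldNormedType.Exports.
Set Implicit Arguments.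
Unset Strict Implicit.
Unset Printing Implicit Defensive.
Local Open Scope classical_set_scope.
Local Open Scope ring_scope.

(* If [q] is periodic and [z] lies on its stable leaf, then [z] returns close to
   [q] at multiples of the period, so [q] is in the closure of the orbit of [z];
   likewise, in backward time, for the unstable leaf.
   Let [p] be periodic and let [K] be the closure of [Fu p].  Where the
   foliations have a local product structure, every periodic [q] close to a
   point of [K] has a stable leaf meeting [Fu p], hence [q] is in [K]; as
   periodic points are dense, [K] is open there.  A singular point has a
   neighbourhood which stays connected once the singular orbit is removed, so
   the singular orbits do not obstruct a clopen argument, and [K = M].
   Given open [U] and [V], take [p] in [V] and [z] in the intersection of [U]
   and [Fu p]: the backward orbit of [z] meets [V].  Baire's theorem then gives
   a dense orbit. *)

(** * Baire's theorem and countable bases in compact spaces *)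

Lemma open_shrink (T : topologicalType) (W : set T) (x : T) :
  regular_space T -> open W -> W x ->
  exists V : set T, [/\ open V, V x & closure V `<=` W].
Proof.
move=> rT oW Wx; have [V Vx VW] := rT x W (open_nbhs_nbhs (conj oW Wx)).
by exists V^°; split; [exact: open_interior | | exact: subset_trans (closureS (@interior_subset _ _)) VW].
Qed.

(** A cluster point of points chosen in nested open sets, each with closure inside the previous set
    and one more [F n], lies in every [F n]. *)
Lemma compact_bigcap_open_dense (T : topologicalType) (F : (set T)^nat) :
  [set: T] !=set0 -> compact [set: T] -> regular_space T ->
  (forall n, open (F n) /\ dense (F n)) -> \bigcap_n F n !=set0.
Proof.
move=> T0 cT rT oF.
have step (n : nat) (V : {V : set T | open V /\ V !=set0}) :
    {W : {V : set T | open V /\ V !=set0} |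
      closure (sval W) `<=` sval V `&` F n}.
  apply: cid; case: V => V /= [oV V0].
  have [oFn dFn] := oF n; have [x VFx] := dFn _ V0 oV.
  have [W [oW Wx WVF]] := open_shrink rT (openI oV oFn) VFx.
  by exists (exist _ W (conj oW (ex_intro _ x Wx))).
pose fix V (n : nat) : {V : set T | open V /\ V !=set0} :=
  if n is m.+1 then sval (step m (V m))
  else exist _ setT (conj openT T0).
have VS n : closure (sval (V n.+1)) `<=` sval (V n) `&` F n.
  exact: (svalP (step n (V n))).
have Vle m n : (m <= n)%N -> sval (V n) `<=` sval (V m).
  move/subnKC <-; elim: (n - m)%N => [|k IH]; first by rewrite addn0.
  rewrite addnS; apply: subset_trans IH => x Vx.
  by have [] := VS _ _ (subset_closure Vx).
have [x xV] := choice (fun n => (svalP (V n)).2).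
have [p [_ clp]] := cT (x @ \oo) _ filterT.
exists p => n _; suff /VS[] : closure (sval (V n.+1)) p by [].
move=> N Np; apply: (clp (sval (V n.+1)) N _ Np).
by exists n.+1 => // k nk; apply: Vle (xV k).
Qed.

Lemma compact_metric_second_countable (R : realType) (M : metricType R) :
  compact [set: M] -> @second_countable M.
Proof.
move=> cM; have [x0|M0] := pselect (exists x : M, True); last first.
  exists set0; first exact: countable0.
  by split=> // x; case: M0; exists x.
pose PM : pseudoPMetricType R :=
  HB.pack (M : Type) M (isPointed.Build M (sval (cid x0))).
exact: (@compact_second_countable R PM).
Qed.

(** * Orbits of a flow: a dense orbit by category, closed periodic orbits *)

Section Flow.
Context {R : realType} {M : metricType R} (phi : R -> M -> M).
Hypothesis fphi : continuous_flow phi.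

Lemma flow_time_continuous t : continuous (phi t).
Proof.
move=> x; apply: (@continuous_comp _ _ _ (fun x => (t, x))
  (fun tx : R * M => phi tx.1 tx.2)); last exact: flow_continuous fphi _.
exact: (cvg_pair (@cvg_cst _ t _ (nbhs x) _) (@cvg_id _ (nbhs x))).
Qed.

Lemma flow_point_continuous x : continuous (phi^~ x).
Proof.
move=> t; apply: (@continuous_comp _ _ _ (fun t => (t, x))
  (fun tx : R * M => phi tx.1 tx.2)); last exact: flow_continuous fphi _.
exact: (cvg_pair (@cvg_id _ (nbhs t)) (@cvg_cst _ x _ (nbhs t) _)).
Qed.

Lemma flow_orbit_sym x y : flow_orbit phi x y -> flow_orbit phi y x.
Proof.
by move=> [t _ <-]; exists (- t) => //; rewrite -(flowD fphi) addNr (flow0 fphi).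
Qed.

Lemma flow_orbit_trans x y z :
  flow_orbit phi x y -> flow_orbit phi y z -> flow_orbit phi x z.
Proof. by move=> [s _ <-] [t _ <-]; exists (t + s) => //; rewrite (flowD fphi). Qed.

(** The points whose orbit meets a given basic open set form an open set, dense by the hypothesis; a
    point common to all these sets has a dense orbit. *)
Lemma transitive_of_orbit_meet :
  [set: M] !=set0 -> compact [set: M] ->
  (forall U V : set M, open U -> open V -> U !=set0 -> V !=set0 ->
     exists2 z, U z & flow_orbit phi z `&` V !=set0) ->
  transitive_flow phi.
Proof.
move=> M0 cM UV.
have [B cB [oB bB]] := compact_metric_second_countable cM.
have [f fB] : exists f : nat -> set M, B `<=` range f.
  have [->|/unsquash f] := pfcard_geP cB; first by exists (fun=> set0).
  by exists f => U /(@surj _ _ _ _ f).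
(* [f] may take empty values or values outside [B]; the two premises make [F n] the whole space
   there. *)
pose F n := [set x | f n !=set0 -> B (f n) -> flow_orbit phi x `&` f n !=set0].
have [n|x Fx] := compact_bigcap_open_dense (F := F) M0 cM (@uniform_regular _).
  have [[fn0 Bfn]|nfB] := pselect (f n !=set0 /\ B (f n)); last first.
    rewrite (_ : F n = setT).
      by split; [exact: openT | move=> ? ? _; rewrite setIT].
    by apply/seteqP; split=> [//|x _ fn0 Bfn]; case: nfB.
  rewrite (_ : F n = \bigcup_t (phi t @^-1` f n)).
    split.
      apply: bigcup_open => t _; apply: open_comp (oB _ Bfn) => x _.
      exact: flow_time_continuous.
    move=> O O0 oO; have [z Oz [y [[t _ <-] fy]]] := UV _ _ oO (oB _ Bfn) O0 fn0.
    by exists z; split=> //; exists t.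
  apply/seteqP; split=> [x /(_ fn0 Bfn)[y [[t _ <-] fy]]|x [t _ fx] _ _].
    by exists t.
  by exists (phi t x); split=> //; exists t.
exists x => O [y Oy] oO.
have [U [BU Uy] UO] := bB y _ (open_nbhs_nbhs (conj oO Oy)).
have [n _ fn] := fB _ BU.
have [||z [xz Uz]] := Fx n I; [by rewrite fn; exists y | by rewrite fn |].
by exists z; split=> //; apply: UO; rewrite /= -fn.
Qed.

Lemma periodic_iter x T n : phi T x = x -> phi (T *+ n) x = x.
Proof.
move=> Tx; elim: n => [|n IH]; first by rewrite mulr0n (flow0 fphi).
by rewrite mulrS (flowD fphi) IH.
Qed.

Lemma periodic_iterN x T n : phi T x = x -> phi (- (T *+ n)) x = x.
Proof.
by move=> Tx; rewrite -[in LHS](periodic_iter n Tx) -(flowD fphi) addNr (flow0 fphi).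
Qed.

(** Removing whole periods brings every time into [[0, T]], so the orbit is a continuous image of a
    compact interval. *)
Lemma periodic_orbit_closed x : periodic_point phi x -> closed (flow_orbit phi x).
Proof.
move=> [_ [T T0 Tx]].
have -> : flow_orbit phi x = (phi^~ x) @` `[0, T].
  apply/seteqP; split=> [_ [t _ <-]|_ [t _ <-]]; last by exists t.
  pose n := Num.floor (t / T).
  have pn : phi (- (T *~ n)) x = x.
    case: n => n; first exact: periodic_iterN.
    by rewrite NegzE mulrNz opprK; exact: periodic_iter.
  exists (t - T *~ n); last by rewrite (flowD fphi) pn.
  have /andP[] := floor_itv (t / T); rewrite -/n intrD mulr1z.
  rewrite ler_pdivlMr// ltr_pdivrMr// mulrDl mul1r mulrzl => nt tn.
  by rewrite /= in_itv /= subr_ge0 nt lerBlDl ltW.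
apply: compact_closed; first exact: metric_hausdorff.
apply: continuous_compact; last exact: segment_compact.
exact/continuous_subspaceT/flow_point_continuous.
Qed.

End Flow.

(** * Geometry of the p-prong model near its core *)

Section ProngModel.
Context {R : realType}.
Implicit Types (p : nat) (z : R * R) (v : R * R * R).

Lemma re_pow_le_modulus p z : `|re_pow p z| <= modulus z ^+ p.
Proof.
have Re_le (w : R[i]) : `|complex.Re w| <= ComplexField.Normc.normc w.
  case: w => a b /=; rewrite -sqrtr_sqr; apply: ler_wsqrtr.
  by rewrite lerDl sqr_ge0.
have -> : modulus z ^+ p = ComplexField.Normc.normc (Complex z.1 z.2 ^+ p).
  elim: p => [|p IH]; first by rewrite !expr0 ComplexField.Normc.normc1.
  by rewrite !exprS ComplexField.Normc.normcM IH.
exact: Re_le.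
Qed.

Lemma prong_origin p : (0 < p)%N ->
  prong_s p (0 : R, 0 : R) = 0 /\ prong_u p (0 : R, 0 : R) = 0.
Proof.
move=> p0; rewrite /prong_s /prong_u.
have m0 : modulus (0 : R, 0 : R) ^+ p = 0.
  by rewrite /modulus /= expr0n addr0 sqrtr0 expr0n; case: p p0.
have := re_pow_le_modulus p (0, 0); rewrite m0 normr_le0 => /eqP ->.
by rewrite subr0 addr0.
Qed.

Lemma prong_eq0 p z : prong_s p z = 0 -> prong_u p z = 0 -> z = (0, 0).
Proof.
rewrite /prong_s /prong_u => s0 u0.
have : modulus z ^+ p = 0 by lra.
move/eqP; rewrite expf_eq0 => /andP[_]; rewrite /modulus sqrtr_eq0.
move=> m0; case: z {s0 u0} m0 => x y /= m0.
have x0 := sqr_ge0 x; have y0 := sqr_ge0 y.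
have /eqP : x ^+ 2 = 0 by lra.
have /eqP : y ^+ 2 = 0 by lra.
by rewrite !expf_eq0 /= => /eqP -> /eqP ->.
Qed.

(** [f] rescales both prong functions, hence fixes their only common zero. The gluing of the
    singular model thus preserves the core. *)
Lemma pA_prong_map_origin p (f : R * R -> R * R) : (0 < p)%N ->
  pA_prong_map p f -> f (0, 0) = (0, 0).
Proof.
move=> p0 [_ [l _ /(_ (0, 0))]]; have [-> ->] := prong_origin p0.
by rewrite !mulr0 => -[]; exact: prong_eq0.
Qed.

(** Here [modulus z < 1/2], so its positive powers stay below [1/2], and each prong function is at
    most twice such a power. *)
Lemma prong_box_small p z : (0 < p)%N -> `|z.1| < 4^-1 -> `|z.2| < 4^-1 ->
  prong_box p z.
Proof.
case: p => // p _ z1 z2.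
have sq (x : R) : `|x| < 4^-1 -> x ^+ 2 < 8^-1.
  by rewrite ltr_norml => /andP[]; nra.
have m2 : modulus z < 2^-1.
  rewrite -(ltr_pXn2r (n := 2)) ?nnegrE ?sqrtr_ge0//.
  rewrite sqr_sqrtr ?addr_ge0 ?sqr_ge0//.
  by have := sq _ z1; have := sq _ z2; lra.
have m0 : 0 <= modulus z := sqrtr_ge0 _.
have mp : modulus z ^+ p.+1 < 2^-1.
  rewrite exprS (le_lt_trans _ m2)// ler_piMr// exprn_ile1//.
  by lra.
have := re_pow_le_modulus p.+1 z; rewrite ler_norml => /andP[r1 r2].
by split; rewrite /prong_s /prong_u; lra.
Qed.

Definition core_ball (t0 e : R) : set (R * R * R) := ball (0, 0, t0) e.

Lemma core_ballP (t0 e : R) v : core_ball t0 e v <->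
  [/\ `|v.1.1| < e, `|v.1.2| < e & `|v.2 - t0| < e].
Proof.
case: v => -[x y] t; split=> /=.
  move=> [[]] /=; rewrite /ball /= !sub0r !normrN => -> -> /=.
  by rewrite distrC.
by move=> [x0 y0 t1]; do 2?split; rewrite /= /ball /= ?sub0r ?normrN// distrC.
Qed.

Lemma lt_affine (c a b s : R) :
  c < a -> c < b -> 0 <= s <= 1 -> c < a + s * (b - a).
Proof.
move=> ca cb /andP[]; rewrite le_eqVlt => /predU1P[<-|s0 s1].
  by rewrite mul0r addr0.
have := mulr_gt0 s0 (_ : 0 < b - c); rewrite subr_gt0 => /(_ cb); nra.
Qed.

Lemma gt_affine (c a b s : R) :
  a < c -> b < c -> 0 <= s <= 1 -> a + s * (b - a) < c.
Proof.
by move=> ac bc s01; have := @lt_affine (- c) (- a) (- b) s; rewrite !ltrN2; lra.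
Qed.

Definition segment (u v : R * R * R) (s : R) : R * R * R :=
  (u.1.1 + s * (v.1.1 - u.1.1), u.1.2 + s * (v.1.2 - u.1.2),
   u.2 + s * (v.2 - u.2)).

Lemma segment_convex_connected (A : set (R * R * R)) :
  (forall u v s, A u -> A v -> 0 <= s <= 1 -> A (segment u v s)) ->
  connected A.
Proof.
move=> cA; have [->|/set0P[u Au]] := eqVneq A set0; first exact: connected0.
have -> : A = \bigcup_(v in A) (segment u v @` `[0, 1]).
  apply/seteqP; split=> [v Av|_ [v Av [s s01 <-]]]; last first.
    by apply: cA => //; move: s01; rewrite /= in_itv.
  exists v => //; exists 1; first by rewrite /= in_itv /= ler01 lexx.
  by rewrite /segment !mul1r !subrKC; case: (v) => -[].
apply: bigcup_connected.
  exists u => v _; exists 0; first by rewrite /= in_itv /= ler01 lexx.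
  by rewrite /segment !mul0r !addr0; case: (u) => -[].
move=> v Av; apply: connected_continuous_connected; first exact: segment_connected.
apply: continuous_subspaceT => s.
have aff (a b : R) : (fun s : R => a + s * b) @ s --> a + s * b.
  by apply: cvgD; [exact: cvg_cst | apply: cvgMr_tmp; exact: cvg_id].
exact: (cvg_pair (cvg_pair (aff _ _) (aff _ _)) (aff _ _)).
Qed.

Definition punctured_ball (t0 e : R) : set (R * R * R) :=
  core_ball t0 e `&` [set v | v.1 != (0, 0)].

(** Off the core one of the two coordinates is positive or negative; the four half-cubes are convex,
    and the three overlaps exhibited below link them. *)
Lemma punctured_ball_connected t0 e : 0 < e -> connected (punctured_ball t0 e).
Proof.
move=> e0.
pose B := core_ball t0 e.
have BP x y : `|x| < e -> `|y| < e -> B (x, y, t0).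
  by move=> xe ye; apply/core_ballP; rewrite /= subrr normr0.
have cB (l : R * R -> R) : (forall u v s, l (segment u v s).1 = l u.1 + s * (l v.1 - l u.1)) ->
    connected (B `&` [set v | 0 < l v.1]).
  move=> lin; apply: segment_convex_connected => u v s.
  move=> [/core_ballP[]]; rewrite !ltr_norml => /andP[? ?] /andP[? ?] /andP[? ?] /= lu.
  move=> [/core_ballP[]]; rewrite !ltr_norml => /andP[? ?] /andP[? ?] /andP[? ?] /= lv.
  move=> s01; split; last by rewrite /= lin; exact: lt_affine.
  apply/core_ballP; split; rewrite /segment /=.
  - by rewrite ltr_norml gt_affine ?lt_affine.
  - by rewrite ltr_norml gt_affine ?lt_affine.
  - by rewrite ltr_distl gt_affine ?lt_affine//; lra.
have -> : punctured_ball t0 e =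
    ((B `&` [set v | 0 < v.1.1]) `|` (B `&` [set v | 0 < v.1.2])) `|`
    (B `&` [set v | 0 < - v.1.1]) `|` (B `&` [set v | 0 < - v.1.2]).
  apply/seteqP; split=> [[[x y] t] [Bv /= xy]|[[x y] t]].
    rewrite /= xpair_eqE negb_and in xy; rewrite !oppr_gt0.
    by move: xy => /orP[] /lt_total/orP[?|?]; tauto.
  by case=> [[[]|]|] [Bv /= xy]; split=> //=; apply/eqP => -[x0 y0]; lra.
have he : `|e / 2| < e by rewrite gtr0_norm; lra.
have hNe : `|- (e / 2)| < e by rewrite normrN.
have z0 : `|0 : R| < e by rewrite normr0.
do 3?[apply: connectedU]; do ?by [
  apply: (cB fst) => u v s; rewrite /segment /=; lra |
  apply: (cB snd) => u v s; rewrite /segment /=; lra |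
  apply: (cB (fun z => - z.1)) => u v s; rewrite /segment /=; lra |
  apply: (cB (fun z => - z.2)) => u v s; rewrite /segment /=; lra].
- exists (e / 2, - (e / 2), t0); split; last by split=> /=; [exact: BP | lra].
  by left; left; split=> /=; [exact: BP | lra].
- exists (- (e / 2), e / 2, t0); split; last by split=> /=; [exact: BP | lra].
  by right; split=> /=; [exact: BP | lra].
- exists (e / 2, e / 2, t0); split; (split=> /=; [exact: BP | lra]).
Qed.

End ProngModel.

(** * Product structure at regular points; charts around core points *)

Section Charts.
Context {R : realType} {M : metricType R}.
Implicit Types (Fs Fu : M -> set M) (U W : set M).

Lemma prong2E (z : R * R) :
  prong_s 2 z = 2 * z.2 ^+ 2 /\ prong_u 2 z = 2 * z.1 ^+ 2.
Proof.
rewrite /prong_s /prong_u /modulus sqr_sqrtr ?addr_ge0 ?sqr_ge0//.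
have -> : re_pow 2 z = z.1 ^+ 2 - z.2 ^+ 2 by rewrite /re_pow expr2 /= !expr2.
by split; lra.
Qed.

Lemma prong_box2E (z : R * R) :
  prong_box 2 z <-> 2 * z.2 ^+ 2 < 1 /\ 2 * z.1 ^+ 2 < 1.
Proof. by rewrite /prong_box /=; have [-> ->] := prong2E z. Qed.

Lemma model_domain2_convex (a b : R) u v (s : R) :
  model_domain 2 a b u -> model_domain 2 a b v -> 0 <= s <= 1 ->
  model_domain 2 a b (segment u v s).
Proof.
have sq (x y : R) : 2 * x ^+ 2 < 1 -> 2 * y ^+ 2 < 1 -> 0 <= s <= 1 ->
    2 * (x + s * (y - x)) ^+ 2 < 1.
  move=> x1 y1 /andP[s0 s1].
  have -> : 2 * (x + s * (y - x)) ^+ 2 =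
      2 * x ^+ 2 + s * (2 * y ^+ 2 - 2 * x ^+ 2) - 2 * (s * (1 - s) * (y - x) ^+ 2).
    by ring.
  have : 0 <= s * (1 - s) * (y - x) ^+ 2.
    by rewrite mulr_ge0 ?sqr_ge0 ?mulr_ge0// subr_ge0.
  have := @gt_affine _ 1 (2 * x ^+ 2) (2 * y ^+ 2) s x1 y1; rewrite s0 s1; lra.
move=> [/prong_box2E[u1 u2]]; rewrite /= in_itv /= => /andP[au bu].
move=> [/prong_box2E[v1 v2]]; rewrite /= in_itv /= => /andP[av bv] s01.
split; first by apply/prong_box2E; split; exact: sq.
by rewrite /= in_itv /= lt_affine ?gt_affine.
Qed.

(** A level set of [q] may consist of several slices of constant [l]; the slice through [v] is
    convex and so lies in a single component. *)
Lemma model_plaque2 (a b : R) (q l : R * R -> R) v w :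
  (forall z z', l z = l z' -> q z = q z') ->
  (forall u v s, l (segment u v s).1 = l u.1 + s * (l v.1 - l u.1)) ->
  model_domain 2 a b v -> model_domain 2 a b w -> l w.1 = l v.1 ->
  model_plaque 2 a b q v w.
Proof.
move=> lq ll Dv Dw lvw.
pose A := model_domain 2 a b `&` [set u | l u.1 = l v.1].
have AC : A `<=` model_plaque 2 a b q v.
  apply: connected_component_max; first by split.
    by move=> u [Du /= lu]; split=> //; exact: lq.
  apply: segment_convex_connected => u u' s [Du /= lu] [Du' /= lu'] s01.
  split; first exact: model_domain2_convex.
  by rewrite /= ll lu lu' subrr mulr0 addr0.
by apply: AC; split.
Qed.

(** Leaves are taken in full, and no uniqueness is asked. One [N] serves all its points, so the
    condition is open. *)
Definition local_product_at Fs Fu (x : M) : Prop :=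
  exists N : set M, [/\ open N, N x &
    forall w q, N w -> N q -> Fu w `&` Fs q !=set0].

Lemma regular_local_product Fs Fu x :
  regular_at Fs Fu x -> local_product_at Fs Fu x.
Proof.
move=> [H [U [[oU [g [_ _ HK gK]] plq] H0]]].
exists U; split=> //.
  rewrite -H0; apply: (HK _ _).1; split; last by rewrite /= in_itv /=; lra.
  by apply/prong_box2E; rewrite /= expr0n /= mulr0.
move=> w q Uw Uq.
have [Dv <-] := gK _ Uw; have [Dv' <-] := gK _ Uq.
set v := g w in Dv *; set v' := g q in Dv' *.
(* Unstable plaques keep the first coordinate and stable ones the second; the time is free. *)
pose z : R * R * R := (v.1.1, v'.1.2, v.2).
have Dz : model_domain 2 (-1) 1 z.
  case: Dv Dv' => /prong_box2E[_ ?] ? [/prong_box2E[? _] _].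
  by split=> //; apply/prong_box2E.
exists (H z); split.
- have [_ eq_u] := plq _ Dv.
  suff : local_part U Fu (H v) (H z) by move/connected_component_sub => -[].
  rewrite eq_u; exists z => //; apply: (model_plaque2 (l := fst)) => //.
  by move=> z1 z2 e; have [_ ->] := prong2E z1; have [_ ->] := prong2E z2; rewrite e.
- have [eq_s _] := plq _ Dv'.
  suff : local_part U Fs (H v') (H z) by move/connected_component_sub => -[].
  rewrite eq_s; exists z => //; apply: (model_plaque2 (l := snd)) => //.
  by move=> z1 z2 e; have [-> _] := prong2E z1; have [-> _] := prong2E z2; rewrite e.
Qed.

(** The homeomorphism [H] carries a small cube about a core point onto an open set; removing the
    core leaves it connected and dense. *)
Lemma chart_punctured_ball Fs Fu p a b H U W (t0 : R) : (0 < p)%N ->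
  bifoliated_chart Fs Fu p a b H U -> a < t0 < b -> open W ->
  W (H (0, 0, t0)) ->
  exists e : R, let B := core_ball t0 e in
  [/\ 0 < e, B `<=` model_domain p a b, open (H @` B), H @` B `<=` W &
      connected (H @` punctured_ball t0 e) /\
      H @` B `<=` closure (H @` punctured_ball t0 e)].
Proof.
move=> p0 [oU [g [cH cg HK gK]] _] /andP[at0 t0b] oW Wx.
(* [1/4] keeps the cube in the prong box, the other two bounds keep its times in []a, b[]. *)
pose e0 := Num.min 4^-1 (Num.min (t0 - a) (b - t0)).
have e00 : 0 < e0 by rewrite !lt_min !subr_gt0 at0 t0b invr_gt0 ltr0n.
have B0D : core_ball t0 e0 `<=` model_domain p a b.
  move=> v /core_ballP; rewrite !lt_min => -[/andP[x _] /andP[y _] /and3P[_ ta tb]].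
  split; first exact: prong_box_small.
  by move: ta tb; rewrite /= in_itv /= !ltr_norml; lra.
have cB0 : {in core_ball t0 e0, continuous H}.
  rewrite -continuous_open_subspace; last exact: ball_open.
  exact: continuous_subspaceW cH.
have c0 e : 0 < e -> core_ball t0 e (0, 0, t0) by exact: ballxx.
have /nbhs_ballP[e1 /= e10 e1W] : nbhs (0 : R, 0 : R, t0) (H @^-1` W).
  by apply: cB0 => //; [rewrite inE; exact: c0 | exact: open_nbhs_nbhs].
pose e := Num.min e0 e1.
have e_gt0 : 0 < e by rewrite lt_min e00.
have BB0 : core_ball t0 e `<=` core_ball t0 e0.
  by apply: le_ball; rewrite ge_min lexx.
have BD := subset_trans BB0 B0D.
exists e; split=> //.
- have -> : H @` core_ball t0 e = U `&` g @^-1` core_ball t0 e.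
    apply/seteqP; split=> [_ [v Bv <-]|y [Uy Bgy]].
      by have [UHv /= gHv] := HK _ (BD _ Bv); split; rewrite //= gHv.
    by exists (g y) => //; have [] := gK _ Uy.
  apply: (iffLR (continuous_inP g oU)); last exact: ball_open.
  by rewrite -continuous_open_subspace.
- move=> _ [v Bv <-]; apply: e1W; move: v Bv; apply: le_ball.
  by rewrite ge_min lexx orbT.
split.
  apply: connected_continuous_connected; first exact: punctured_ball_connected.
  by apply: continuous_subspaceW cH => v [/BD].
move=> _ [v Bv <-] N Nv.
have [v0|v0] := eqVneq v.1 (0, 0); last first.
  by exists (H v); split; [exists v | exact: nbhs_singleton].
have : nbhs v (core_ball t0 e `&` H @^-1` N).
  apply: filterI; first by apply: open_nbhs_nbhs; split; [exact: ball_open|].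
  by apply: cB0 => //; rewrite inE; exact: BB0.
move=> /nbhs_ballP[d /= d0 dN].
have [|Bw Nw] := dN (d / 2, 0, v.2).
  move: v v0 {Bv Nv dN} => [[x y] t] /= [-> ->].
  by apply/core_ballP; split; rewrite /= ?subrr ?normr0 ?gtr0_norm; lra.
exists (H (d / 2, 0, v.2)); split=> //; exists (d / 2, 0, v.2) => //; split=> //=.
by apply/eqP => -[]; lra.
Qed.

End Charts.

(** * Singular orbits, and a clopen argument that passes them *)

Section Singular.
Context {R : realType} {M : metricType R}.
Implicit Types (Fs Fu : M -> set M) (D : set M).

(** [D] will be the union of the other singular orbits. Other passages of the orbit through the
    small cube are excluded, because the orbit is the image of the core and charts are injective. *)
Lemma prong_core_punctured_nbhd (phi : R -> M -> M) Fs Fu p x0 x D :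
  (0 < p)%N -> prong_type_along_orbit phi Fs Fu p x0 -> flow_orbit phi x0 x ->
  closed D -> ~ D x ->
  exists N P : set M, [/\ open N, N x, connected P, N `<=` closure P &
    P `<=` ~` (D `|` flow_orbit phi x0)].
Proof.
move=> p0 [f [H [fpA chart glue core]]] + clD nDx; rewrite -core => -[t1 t11 xt1].
pose c t := H (0, 0, t).
have box0 : prong_box p (0 : R, 0 : R).
  by apply: prong_box_small; rewrite //= normr0 invr_gt0.
have shift t : 0 < t < 1 -> c t = c (t - 1).
  by move=> t01; rewrite /c glue ?(pA_prong_map_origin p0 fpA).
(* In one chart, of time length 1, only core points are sent to core points. *)
have inj a z t t' : -1 <= a <= 0 -> prong_box p z -> a < t < a + 1 ->
    a < t' < a + 1 -> H (z, t) = c t' -> z = (0, 0) /\ t = t'.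
  move=> /chart[U [_ [g [_ _ HK _]] _]] bz ta t'a Hc.
  have [|_ gH] := HK (z, t); first by split; rewrite //= in_itv.
  have [|_ gc] := HK (0, 0, t'); first by split; rewrite //= in_itv.
  by move: gH; rewrite Hc gc => -[<- <-].
(* With [t0] in [[-1/2, 1/2]], the interval of length 1 centred at [t0] has its left end in
   [[-1, 0]], as charts require. *)
have [t0 xt0 t0h] : exists2 t0, c t0 = x & - 2^-1 <= t0 <= 2^-1.
  move: t11; rewrite /= in_itv /= => /andP[? ?].
  have [?|?] := lerP t1 (- 2^-1).
    by exists (t1 + 1); [rewrite shift ?addrK//; lra | lra].
  have [?|?] := lerP t1 2^-1; first by exists t1 => //; lra.
  by exists (t1 - 1); [rewrite -shift//; lra | lra].
(* The chart around [x] covers the whole core except the antipodal point. *)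
pose t2 := if t0 <= 0 then t0 + 2^-1 else t0 - 2^-1.
have x_t2 : x <> c t2.
  (* Both [t0] and [t2] lie in one chart interval, starting at [t0 - 1/4] or [t0 - 3/4], so
     injectivity separates them. *)
  rewrite /t2 -xt0; case: ifPn => t00; last rewrite -ltNge in t00.
    by case/(@inj (t0 - 4^-1)) => //; lra.
  by case/(@inj (t0 - 3 / 4)) => //; lra.
pose W := ~` (D `|` [set c t2]).
have oW : open W.
  apply: closed_openC; apply: closedU => //.
  by apply: compact_closed; [exact: metric_hausdorff | exact: compact_set1].
have [|U ch] := chart (t0 - 2^-1); first lra.
have [||e [e0 BD oHB HBW [cP clP]]] :=
  chart_punctured_ball (t0 := t0) p0 ch _ oW.
- by lra.
- by rewrite [H _]xt0 => -[].
exists (H @` core_ball t0 e), (H @` punctured_ball t0 e); split=> //.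
  by exists (0, 0, t0) => //; exact: ballxx.
move=> _ [[z t] [Bzt /= z0] <-] [DH|].
  by apply: HBW; [exists (z, t) | left].
move=> -[s]; rewrite /= in_itv /= => s11 /esym cs.
have [/= bz] := BD _ Bzt; rewrite in_itv /= => tt0.
have nt2 : c s <> c t2.
  by move=> st2; apply: (HBW (H (z, t))); [exists (z, t) | right; rewrite cs].
have core_z s' : t0 - 2^-1 < s' < t0 + 2^-1 -> c s = c s' -> False.
  move=> s'h ss'; move/eqP: z0; apply.
  have [| | |->] // := inj (t0 - 2^-1) z t s' _ bz tt0; [lra | lra | by rewrite -ss' cs].
(* One of [s], [s + 1], [s - 1] falls in the open time interval of the chart, unless [s] is
   [t0 - 1/2] or [t0 + 1/2], which both give the antipodal point. *)
have [ls|ls|ls] := ltgtP s (t0 - 2^-1).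
- apply: (core_z (s + 1)); first lra.
  by rewrite (shift (s + 1)) ?addrK//; lra.
- have [gs|gs|gs] := ltgtP s (t0 + 2^-1).
  + by apply: (core_z s) => //; lra.
  + apply: (core_z (s - 1)); first lra.
    by rewrite -shift//; lra.
  + apply: nt2; rewrite /t2 -gs; case: ifPn => // t00.
    rewrite -ltNge in t00; rewrite shift; last lra.
    by congr c; lra.
- apply: nt2; rewrite /t2; case: ifPn => [t00|_]; last by rewrite ls.
  rewrite (shift (t0 + 2^-1)); last lra.
  by congr c; lra.
Qed.

End Singular.

(** The interior of [K] is closed: at a limit point off [G], the trace of [K] is clopen in the
    connected set [P], so [K] contains [P] and, being closed, [N]. *)
Lemma punctured_clopen_fullT (T : topologicalType) (G K : set T) :
  connected [set: T] -> closed K -> K°!=set0 -> K `&` G `<=` K° ->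
  (forall x, ~ G x -> exists N P : set T,
     [/\ open N, N x, connected P, N `<=` closure P & P `<=` G]) ->
  K = setT.
Proof.
move=> cT clK K0 KG sing.
suff clKo : closure K° `<=` K°.
  have cK : closed K° by [].
  have KT : K° = setT.
    by apply: cT => //; exists K°; rewrite ?setTI//; exact: open_interior.
  by rewrite -subTset -KT; exact: interior_subset.
move=> x xK.
have Kx : K x := clK _ (closureS (@interior_subset _ K) xK).
have [Gx|nGx] := pselect (G x); first exact: KG.
have [N [P [oN Nx cP NP PG]]] := sing x nGx.
have PK : P `&` K = P.
  apply: cP.
  - have [y [Ky Ny]] := xK N (open_nbhs_nbhs (conj oN Nx)).
    have [w [Pw Kw]] := NP y Ny K° (open_nbhs_nbhs (conj (@open_interior _ _) Ky)).
    by exists w; split=> //; exact: interior_subset.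
  - exists K°; first exact: open_interior.
    apply/seteqP; split=> y [Py Ky]; split=> //; last exact: interior_subset.
    by apply: KG; split=> //; exact: PG.
  - by exists K.
have NK : N `<=` K.
  apply: (subset_trans NP); rewrite [X in _ `<=` X](closure_id K).1//.
  by apply: closureS; rewrite -PK; exact: subIsetr.
exact: filterS NK (open_nbhs_nbhs (conj oN Nx)).
Qed.

Lemma cvg_mulrn (R : realType) (P : R) : 0 < P -> P *+ n @[n --> \oo] --> +oo.
Proof.
move=> P0; under eq_fun do rewrite -mulr_natr.
exact: (@gt0_cvgMry R ((fun n => n%:R) @ \oo) _ P id P0 cvgr_idn).
Qed.

(** * Returns to periodic points, closures of unstable leaves, transitivity *)

Section Transitivity.
Context {R : realType} {M : metricType R} (phi : R -> M -> M).
Implicit Types F : M -> set M.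
Hypothesis fphi : continuous_flow phi.

(** At the times [u n] the point [q] is back at itself while the reparametrised orbit of [z] draws
    near. The filter [T] allows both time directions. *)
Lemma asymptotic_returns_closure F (T : set_system R) (u : nat -> R) q z :
  asymptotic_along phi F T -> u @ \oo --> T -> (forall n, phi (u n) q = q) ->
  F q z -> closure (flow_orbit phi z) q.
Proof.
move=> aF uT uq /aF[h _ hq] N /nbhs_ballP[e /= e0 eN].
have : (fun n => mdist (phi (u n) q) (phi (h (u n)) z)) @ \oo --> (0 : R).
  exact: cvg_trans (cvg_app _ uT) hq.
move=> /cvgrPdist_lt/(_ e e0)[n _ /(_ n (leqnn n))] /=.
rewrite uq sub0r normrN ger0_norm ?mdist_ge0// => qe.
exists (phi (h (u n)) z); split; first by exists (h (u n)).
by apply: eN; rewrite ballEmdist.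
Qed.

Lemma stable_leaf_returns F q z : asymptotic_along phi F +oo ->
  periodic_point phi q -> F q z -> closure (flow_orbit phi z) q.
Proof.
move=> aF [_ [P P0 Pq]]; apply: asymptotic_returns_closure aF (cvg_mulrn P0) _.
by move=> n; exact: periodic_iter.
Qed.

Lemma unstable_leaf_returns F q z : asymptotic_along phi F -oo ->
  periodic_point phi q -> F q z -> closure (flow_orbit phi z) q.
Proof.
move=> aF [_ [P P0 Pq]].
apply: (asymptotic_returns_closure (u := fun n => - (P *+ n)) aF).
  by apply/cvgNrNy; exact: cvg_mulrn.
by move=> n; exact: periodic_iterN.
Qed.

(** [Fu p] is a union of orbits, so it contains the whole orbit of a point where it meets the stable
    leaf of a periodic [q]; this orbit accumulates on [q], and such [q] are dense in [N]. *)
Lemma local_product_closure_leaf Fs Fu p x :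
  leaf_partition Fu -> invariant_foliation phi Fu ->
  asymptotic_along phi Fs +oo -> dense [set q | periodic_point phi q] ->
  local_product_at Fs Fu x -> closure (Fu p) x -> (closure (Fu p))° x.
Proof.
move=> lFu iFu aFs per [N [oN Nx prod]] clx.
have [w [pw Nw]] := clx N (open_nbhs_nbhs (conj oN Nx)).
apply: filterS (open_nbhs_nbhs (conj oN Nx)) => y Ny.
suff perN : N `&` [set q | periodic_point phi q] `<=` closure (Fu p).
  move=> V /= Vy; have VN : nbhs y (V° `&` N).
    by apply: filterI; [exact: nbhs_interior | exact: open_nbhs_nbhs].
  have [||q [[Vq Nq] qper]] := per (V° `&` N).
  - by exists y; exact: nbhs_singleton VN.
  - by apply: openI => //; exact: open_interior.
  by apply: perN Vq; split.
move=> q [Nq qper]; have [z [wz qz]] := prod w q Nw Nq.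
apply: closureS (stable_leaf_returns aFs qper qz) => _ [t _ <-].
by rewrite (leaf_eq lFu pw) (leaf_eq lFu wz); exact: iFu.
Qed.

Lemma local_product_or_punctured Fs Fu x : pA_foliations phi Fs Fu ->
  ~ local_product_at Fs Fu x -> exists N P : set M,
    [/\ open N, N x, connected P, N `<=` closure P &
      P `<=` local_product_at Fs Fu].
Proof.
move=> [[S [finS perS prongS regS]] _] nx.
have [x0 Sx0 x0x] : (\bigcup_(s in S) flow_orbit phi s) x.
  by apply: contrapT => /regS /regular_local_product.
(* [S] may hold several points of the orbit of [x]; all of them are set aside, so that the remaining
   orbits miss [x]. *)
pose S' := S `&` [set s | ~ flow_orbit phi s x].
have clD : closed (\bigcup_(s in S') flow_orbit phi s).
  apply: closed_bigcup; first by apply: sub_finite_set finS; exact: subIsetl.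
  by move=> s [Ss _]; apply: periodic_orbit_closed => //; exact: perS.
have [p p3 prong] := prongS _ Sx0.
have [|N [P [oN Nx cP NP PD]]] :=
  prong_core_punctured_nbhd (ltn_trans (isT : 0 < 2)%N p3) prong x0x clD.
  by move=> [s [_ nsx]].
exists N, P; split=> // y /PD/not_orP[yD yx0].
apply/regular_local_product/regS => -[s Ss sy].
have [sx|nsx] := pselect (flow_orbit phi s x); last by apply: yD; exists s.
apply: yx0; apply: flow_orbit_trans x0x _ => //.
by apply: flow_orbit_trans (flow_orbit_sym _ sx) sy.
Qed.

End Transitivity.

Theorem theorem1p5 (R : realType) (M : metricType R) (phi : R -> M -> M)
    (hM : compact_connected_manifold 3 M)
    (hphi : topological_pseudo_Anosov phi)
    (hper : dense [set x : M | periodic_point phi x]%classic) :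
  transitive_flow phi.
Proof.
have [M0 cM conM _] := hM.
have [fphi _ [Fs [Fu [[lFs lFu] [_ iFu] pAF [aFs aFu] _]]]] := hphi.
pose G := local_product_at Fs Fu.
have sing x : ~ G x -> exists N P : set M,
    [/\ open N, N x, connected P, N `<=` closure P & P `<=` G].
  exact: (local_product_or_punctured fphi pAF).
have oG : open G.
  rewrite openE => x [N [oN Nx prod]]; apply: filterS (open_nbhs_nbhs (conj oN Nx)).
  by move=> y Ny; exists N.
(* A point outside [G] is in the closure of its [P], which lies in [G]. *)
have dG : dense G.
  move=> U [x Ux] oU; have [Gx|/sing[N [P [_ Nx _ NP PG]]]] := pselect (G x).
    by exists x.
  have [y [Py Uy]] := NP x Nx U (open_nbhs_nbhs (conj oU Ux)).
  by exists y; split=> //; exact: PG.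
apply: (transitive_of_orbit_meet fphi M0 cM) => U V oU oV U0 V0.
(* Taking [p] in [G] as well as in [V] makes the closure of [Fu p] a neighbourhood of [p], which
   starts the clopen argument. *)
have [p [[Vp Gp] pper]] := hper _ (dG V V0 oV) (openI oV oG).
have KT : closure (Fu p) = setT.
  have KG : closure (Fu p) `&` G `<=` (closure (Fu p))°.
    by move=> x [Kx Gx]; exact: (local_product_closure_leaf fphi lFu iFu aFs hper Gx Kx).
  apply: (punctured_clopen_fullT conM (@closed_closure _ _) _ KG sing).
  exists p; apply: KG; split=> //; apply: subset_closure; exact: leaf_refl.
have [u Uu] := U0.
have [z [pz Uz]] : Fu p `&` U !=set0.
  have : closure (Fu p) u by rewrite KT.
  by apply; exact: open_nbhs_nbhs.
exists z => //; apply: (unstable_leaf_returns fphi aFu pper pz).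
exact: open_nbhs_nbhs.
Qed.
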